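(* For each word $w$ in the following families, the equation $w(X,A)=B$ is not solvable in terms of radicals: (i) $X^nAX^m$, where $m,n\ge 1$ and $m\ne n$; (ii) $XA^{m+2n}XA^{m+n}XA^mX$, where $m\ge 0$ and $n\ge 1$; (iii) $XAX^nAX$, where $n\ge 3$; (iv) $X^2(AX)^nX$, where $n\ge 2$. (Here $m,n$ are integers.)
   Context: A group $G$ is uniquely divisible if for every $g\in G$ and each positive integer $m$ there exists a unique $h\in G$ with $h^m=g$, denoted $g^{1/m}$; for $n\in\mathbb{Z}$, $m\ge 1$ put $g^{n/m}:=(g^n)^{1/m}$. Let $S$ be the smallest set of finite formal expressions in the letters $A,B$ that contains the empty expression and the letters, and is closed under concatenation and under taking (parenthesized) powers with exponents $n/m$, $n\in\mathbb{Z}$, $m\ge 1$. Each $e\in S$ can be evaluated at elements $a,b$ of a uniquely divisible group $G$, giving $e(a,b)\in G$. Write $e\sim f$ if $e(a,b)=f(a,b)$ for all $a,b\in G$ and every uniquely divisible group $G$, and let $[e]$ be the equivalence class of $e$. The set $\mathcal{F}=\{[e]:e\in S\}$ with multiplication $[e]\cdot[f]=[ef]$ is a uniquely divisible group, called the free uniquely divisible group on $\{A,B\}$. For a finite word $w$ in the alphabet $\{X,A\}$, $w(g,a)$ denotes the result of substituting $g$ for the letter $X$ and $a$ for the letter $A$. The equation $w(X,A)=B$ is solvable in terms of radicals if $w(X,[A])=[B]$ has a solution $X\in\mathcal{F}$. *)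

(* Defs.v *)
From HB Require Import structures.
From mathcomp Require Import all_boot all_order all_algebra.
From mathcomp Require Import monoid generic_quotient boolp classical_sets.

Set Implicit Arguments.
Unset Strict Implicit.
Unset Printing Implicit Defensive.

Local Open Scope group_scope.
Local Open Scope quotient_scope.

(* [groupType] is the structure of arbitrary, possibly infinite, groups.  It
   carries decidable equality and a choice operator; [gen_eqMixin] and
   [gen_choiceMixin] provide these on every type, so that no group is excluded
   by quantifying over it. *)
Definition uniquely_divisible (G : groupType) : Prop :=
  forall (g : G) (m : nat), (0 < m)%N -> exists! h : G, h ^+ m = g.

(* The root g^{1/m}, with default value 1 when no root exists, so that it is a
   total operation; [grootK] and [groot_unique] say that it is the unique m-th
   root as soon as G is uniquely divisible and m > 0. *)
Definition groot (G : groupType) (g : G) (m : nat) : G :=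
  xget 1 [set h : G | h ^+ m = g]%classic.

Definition zpowg (G : groupType) (g : G) (n : int) : G :=
  match n with
  | Posz k => g ^+ k
  | Negz k => g ^- k.+1
  end.

Definition fracpowg (G : groupType) (g : G) (n : int) (m : nat) : G :=
  groot (zpowg g n) m.

Lemma grootK (G : groupType) (udG : uniquely_divisible G) (g : G) (m : nat) :
  (0 < m)%N -> groot g m ^+ m = g.
Proof.
move=> m_gt0; have [h [hm _]] := udG g m m_gt0.
by apply: (@xgetPex _ 1 [set h : G | h ^+ m = g]%classic); exists h.
Qed.

Lemma groot_unique (G : groupType) (udG : uniquely_divisible G) (g h : G)
    (m : nat) : (0 < m)%N -> h ^+ m = g -> h = groot g m.
Proof.
move=> m_gt0 hm; have [k [_ uk]] := udG g m m_gt0.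
by rewrite -(uk _ hm) -(uk _ (grootK udG g m_gt0)).
Qed.

(* [EPow e n m] is e^{n/(m+1)}.  Concatenation is a binary node, so
   expressions are recorded with a bracketing; evaluation does not see it. *)
Inductive expr : Type :=
| EEmpty
| EA
| EB
| ECat (e f : expr)
| EPow (e : expr) (n : int) (m : nat).

HB.instance Definition _ := gen_eqMixin expr.
HB.instance Definition _ := gen_choiceMixin expr.

Fixpoint eval (G : groupType) (a b : G) (e : expr) : G :=
  match e with
  | EEmpty => 1
  | EA => a
  | EB => b
  | ECat e f => eval a b e * eval a b f
  | EPow e n m => fracpowg (eval a b e) n m.+1
  end.

Definition expr_equiv (e f : expr) : Prop :=
  forall G : groupType, uniquely_divisible G ->
  forall a b : G, eval a b e = eval a b f.

Definition expr_equivb (e f : expr) : bool := `[< expr_equiv e f >].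

Lemma expr_equivb_refl : reflexive expr_equivb.
Proof. by move=> e; apply/asboolP. Qed.

Lemma expr_equivb_sym : symmetric expr_equivb.
Proof.
by move=> e f; apply/asboolP/asboolP => ef G udG a b; rewrite ef.
Qed.

Lemma expr_equivb_trans : transitive expr_equivb.
Proof.
move=> f e g /asboolP ef /asboolP fg; apply/asboolP => G udG a b.
by rewrite ef // fg.
Qed.

Canonical expr_equiv_rel :=
  EquivRel expr_equivb expr_equivb_refl expr_equivb_sym expr_equivb_trans.

Definition freeUD : Type := {eq_quot expr_equivb}.
HB.instance Definition _ := EqQuotient.on freeUD.
HB.instance Definition _ := Choice.on freeUD.

Definition cls (e : expr) : freeUD := \pi_freeUD e.

Lemma clsP (e f : expr) : cls e = cls f <-> expr_equiv e f.
Proof.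
split; first by move=> /eqmodP /asboolP.
by move=> ef; apply/eqmodP/asboolP.
Qed.

Lemma repr_cls (e : expr) : expr_equiv (repr (cls e)) e.
Proof. by apply/clsP; rewrite /cls reprK. Qed.

Lemma cls_repr (x : freeUD) : cls (repr x) = x.
Proof. exact: reprK. Qed.

Definition fud_mul (x y : freeUD) : freeUD := cls (ECat (repr x) (repr y)).
Definition fud_one : freeUD := cls EEmpty.
Definition fud_inv (x : freeUD) : freeUD := cls (EPow (repr x) (Negz 0) 0).

Lemma fud_mul_cls (e f : expr) : fud_mul (cls e) (cls f) = cls (ECat e f).
Proof.
by apply/clsP => G udG a b /=; rewrite (repr_cls e udG) (repr_cls f udG).
Qed.

Lemma eval_inv (G : groupType) (udG : uniquely_divisible G) (a b : G)
    (e : expr) : eval a b (EPow e (Negz 0) 0) = (eval a b e)^-1.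
Proof. by rewrite /= /fracpowg /=; apply/esym/groot_unique. Qed.

Lemma fud_inv_cls (e : expr) : fud_inv (cls e) = cls (EPow e (Negz 0) 0).
Proof. by apply/clsP => G udG a b; rewrite !eval_inv // (repr_cls e udG). Qed.

Lemma fud_mulA : associative fud_mul.
Proof.
move=> x y z; rewrite -[x]cls_repr -[y]cls_repr -[z]cls_repr !fud_mul_cls.
by apply/clsP => G udG a b /=; rewrite mulgA.
Qed.

Lemma fud_mul1x : left_id fud_one fud_mul.
Proof.
move=> x; rewrite -[x]cls_repr fud_mul_cls.
by apply/clsP => G udG a b /=; rewrite mul1g.
Qed.

Lemma fud_mulx1 : right_id fud_one fud_mul.
Proof.
move=> x; rewrite -[x]cls_repr fud_mul_cls.
by apply/clsP => G udG a b /=; rewrite mulg1.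
Qed.

Lemma fud_mulVx : left_inverse fud_one fud_inv fud_mul.
Proof.
move=> x; rewrite -[x]cls_repr fud_inv_cls fud_mul_cls.
apply/clsP => G udG a b.
have -> : eval a b (ECat (EPow (repr x) (Negz 0) 0) (repr x)) =
  eval a b (EPow (repr x) (Negz 0) 0) * eval a b (repr x) by [].
by rewrite eval_inv // mulVg.
Qed.

Lemma fud_mulxV : right_inverse fud_one fud_inv fud_mul.
Proof.
move=> x; rewrite -[x]cls_repr fud_inv_cls fud_mul_cls.
apply/clsP => G udG a b.
have -> : eval a b (ECat (repr x) (EPow (repr x) (Negz 0) 0)) =
  eval a b (repr x) * eval a b (EPow (repr x) (Negz 0) 0) by [].
by rewrite eval_inv // mulgV.
Qed.

HB.instance Definition _ := isGroup.Build freeUD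
  fud_mulA fud_mul1x fud_mulx1 fud_mulVx fud_mulxV.

Lemma cls_mul (e f : expr) : cls e * cls f = cls (ECat e f).
Proof. exact: fud_mul_cls. Qed.

Lemma eval_expn (G : groupType) (udG : uniquely_divisible G) (a b : G)
    (e : expr) (m : nat) :
  eval a b (EPow e (Posz m) 0) = eval a b e ^+ m.
Proof. by rewrite /= /fracpowg /=; apply/esym/groot_unique. Qed.

Lemma cls_exp (e : expr) (m : nat) :
  cls e ^+ m = cls (EPow e (Posz m) 0).
Proof.
have -> : cls e ^+ m = cls (iter m (ECat e) EEmpty).
  by elim: m => [//|m IHm]; rewrite expgS IHm cls_mul.
apply/clsP => G udG a b; rewrite eval_expn //.
by elim: m => [//|m IHm]; rewrite iterS /= IHm expgS.
Qed.

Lemma freeUD_uniquely_divisible : uniquely_divisible freeUD.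
Proof.
move=> x m m_gt0; rewrite -[x]cls_repr; move: (repr x) => e.
exists (cls (EPow e (Posz 1) m.-1)); split.
  rewrite cls_exp; apply/clsP => G udG a b.
  rewrite eval_expn // [eval a b (EPow e _ _)]/= /fracpowg prednK //.
  exact: grootK.
move=> y; rewrite -[y]cls_repr cls_exp => /clsP ye; apply/clsP => G udG a b.
rewrite [LHS]/= /fracpowg prednK //=; apply/esym/groot_unique => //.
by rewrite -eval_expn // ye.
Qed.

Inductive wletter : Type := LX | LA.

Definition word : Type := seq wletter.

Definition wsubst (G : groupType) (w : word) (g a : G) : G :=
  \prod_(l <- w) (match l with LX => g | LA => a end).

Definition solvable_by_radicals (w : word) : Prop :=
  exists X : freeUD, wsubst w X (cls EA) = cls EB.

(* Main.v *)
Require Import Defs.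
From mathcomp Require Import all_boot.
From HB Require Import structures.
From mathcomp Require Import all_order all_algebra monoid.
From mathcomp Require Import Rstruct reals sequences exp trigo.
From mathcomp Require Import complex polyrcf ring lra.
Import Order.TTheory GRing.Theory Num.Theory.

(** If w(X,A) = B is solvable by radicals, then it has a solution for every choice
    of a and b in every uniquely divisible group, since the radical expression
    can be evaluated there ([solvable_in_groups]). So it is enough to find one
    uniquely divisible group in which some instance w(X,a) = b has no solution.

    The groups used are affine groups: the pairs (r, u) of an exponent r : F and
    a translation u : K, where (r, u) acts on K by z |-> chi(r) z + u for a
    character chi : F -> K^*. An m-th power multiplies the translation by
    1 + chi(r) + ... + chi(r)^(m-1), which can vanish only if chi(r) is a
    nontrivial root of unity; if the values of chi contain none, then the group
    is uniquely divisible ([affine_uniquely_divisible]). For a = (s, 0), the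
    translation part of w((r, u), a) is P u, where P is the sum, over the
    occurrences of X in w, of the product of chi(r) and chi(s) along the prefix
    of w before that occurrence. This P is the Fox derivative of w with respect
    to X, at the point x = chi(r), a = chi(s). When X occurs in w, comparing
    exponents determines r, so if P vanishes for one choice of r and s, then no
    element with the corresponding exponent and translation part 1 can be
    reached ([fox_root_unsolvable]).

    The coefficients of P are positive, so real characters, whose values are
    squares, give no zero. The characters used here are the next simplest:
    r |-> (-t)^r, where t is a positive real number and (-t)^r is read as t^r e^(i pi r). For t <> 1 its
    values at r <> 0 have absolute value different from 1, hence are not roots
    of unity. Suitable real exponents r and s, chosen for each family, turn P
    into a real polynomial in t, and the intermediate value theorem gives a
    root t > 0 with t <> 1 ([unbalanced_root], [palindromic_root],
    [cubic_root]). *)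

Set Implicit Arguments.
Unset Strict Implicit.
Unset Printing Implicit Defensive.

(** * Evaluating a solution in uniquely divisible groups *)

Section Evaluation.
Local Open Scope group_scope.

Lemma solvable_in_groups (w : word) : solvable_by_radicals w ->
  forall G : groupType, uniquely_divisible G ->
  forall a b : G, exists g : G, wsubst w g a = b.
Proof.
case=> X; rewrite -[X]cls_repr; move: (repr X) => e.
have -> : wsubst w (cls e) (cls EA) =
    cls (foldr ECat EEmpty [seq if l is LX then e else EA | l <- w]).
  rewrite /wsubst; elim: w => [|l w IHw]; first by rewrite big_nil.
  by rewrite big_cons IHw /=; case: l; rewrite cls_mul.
move=> /clsP eqB G udG a b; exists (eval a b e).
rewrite -[RHS](eqB G udG a b) /wsubst.
elim: w {eqB} => [|l w IHw]; first by rewrite big_nil.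
by rewrite big_cons IHw; case: l.
Qed.

End Evaluation.

Local Open Scope ring_scope.

(** * Fox derivatives of words *)

Section FoxDerivative.
Variable K : comNzRingType.
Implicit Types (x a : K) (w : word).

(** The Fox derivative of [w] with respect to X, after abelianization, at the
    point [(x, a)]. *)
Fixpoint fox w x a : K :=
  match w with
  | [::] => 0
  | LX :: w' => 1 + x * fox w' x a
  | LA :: w' => a * fox w' x a
  end.

Fixpoint ab_eval w x a : K :=
  match w with
  | [::] => 1
  | LX :: w' => x * ab_eval w' x a
  | LA :: w' => a * ab_eval w' x a
  end.

Definition isX (l : wletter) := if l is LX then true else false.

Lemma fox_noX w x a : count isX w = 0%N -> fox w x a = 0.
Proof. by elim: w => [|[] w IHw] //= /IHw ->; rewrite mulr0. Qed.

Lemma ab_eval_cat v w x a : ab_eval (v ++ w) x a = ab_eval v x a * ab_eval w x a.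
Proof. by elim: v => [|[] v IHv] /=; rewrite ?mul1r // IHv mulrA. Qed.

Lemma fox_cat v w x a :
  fox (v ++ w) x a = fox v x a + ab_eval v x a * fox w x a.
Proof. by elim: v => [|[] v IHv] /=; rewrite ?IHv; ring. Qed.

Lemma ab_eval_nseqX n x a : ab_eval (nseq n LX) x a = x ^+ n.
Proof. by elim: n => [|n IHn] //=; rewrite IHn exprS. Qed.

Lemma ab_eval_nseqA n x a : ab_eval (nseq n LA) x a = a ^+ n.
Proof. by elim: n => [|n IHn] //=; rewrite IHn exprS. Qed.

Lemma fox_nseqA n x a : fox (nseq n LA) x a = 0.
Proof. by elim: n => [|n IHn] //=; rewrite IHn mulr0. Qed.

Lemma ab_eval_pow n w x a :
  ab_eval (flatten (nseq n w)) x a = ab_eval w x a ^+ n.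
Proof. by elim: n => [|n IHn] //=; rewrite ab_eval_cat IHn exprS. Qed.

Lemma fox_pow n w x a : fox (flatten (nseq n w)) x a =
  fox w x a * \sum_(k < n) ab_eval w x a ^+ k.
Proof.
elim: n => [|n IHn] /=; first by rewrite big_ord0 mulr0.
rewrite fox_cat IHn big_ord_recl expr0 mulrDr mulr1 mulrCA mulr_sumr.
by congr (_ + _ * _); apply: eq_bigr => k _; rewrite -exprS.
Qed.

Lemma fox_nseqX n x a : fox (nseq n LX) x a = \sum_(k < n) x ^+ k.
Proof.
have -> : nseq n LX = flatten (nseq n [:: LX]) by elim: n => //= n <-.
by rewrite fox_pow /= !mulr1 mulr0 addr0 mul1r.
Qed.

End FoxDerivative.

(** This lets a Fox derivative be computed over the reals even though the
    characters take complex values. *)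
Lemma fox_morph (K L : comNzRingType) (f : {rmorphism K -> L}) w (x a : K) :
  fox w (f x) (f a) = f (fox w x a).
Proof.
elim: w => [|[] w IHw] /=; first by rewrite rmorph0.
  by rewrite IHw rmorphD rmorph1 rmorphM.
by rewrite IHw rmorphM.
Qed.

Lemma sum_expr1n (K : pzSemiRingType) n : \sum_(k < n) 1 ^+ k = n%:R :> K.
Proof.
by under eq_bigr do rewrite expr1n; rewrite sumr_const card_ord.
Qed.

(** * Affine groups attached to characters *)

(** An injective character whose values contain no nontrivial root of unity;
    injectivity is the case m = 1 of the last condition. *)
Record tf_character (F K : numFieldType) := TfCharacter {
  char_val :> F -> K;
  char0 : char_val 0 = 1;
  charD : forall r s, char_val (r + s) = char_val r * char_val s;
  char_tf : forall r m, (0 < m)%N -> char_val r ^+ m = 1 -> r = 0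
}.

Section AffineGroup.
Variables (F K : numFieldType) (chi : tf_character F K).
Implicit Types (r s : F) (u v : K) (w : word).

Definition affine : Type := (F * K)%type.
HB.instance Definition _ := Choice.on affine.
Implicit Types g h : affine.

(** The pair (r, u) stands for the affine map z |-> chi r * z + u; keeping the
   exponent r rather than chi r makes division by m on that factor canonical. *)
Definition affine_mul g h : affine := (g.1 + h.1, g.2 + chi g.1 * h.2).
Definition affine_one : affine := (0, 0).
Definition affine_inv g : affine := (- g.1, - (chi (- g.1) * g.2)).

Lemma affine_mulA : associative affine_mul.
Proof.
move=> [r u] [s v] [t z]; rewrite /affine_mul /= charD.
by congr pair; ring.
Qed.

Lemma affine_mul1g : left_id affine_one affine_mul.
Proof. by case=> r u; rewrite /affine_mul /= char0 mul1r !add0r. Qed.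

Lemma affine_mulg1 : right_id affine_one affine_mul.
Proof. by case=> r u; rewrite /affine_mul /= mulr0 !addr0. Qed.

Lemma affine_mulVg : left_inverse affine_one affine_inv affine_mul.
Proof. by case=> r u; rewrite /affine_mul /= !addNr. Qed.

Lemma affine_mulgV : right_inverse affine_one affine_inv affine_mul.
Proof.
by case=> r u; rewrite /affine_mul /= mulrN mulrA -charD subrr char0 mul1r subrr.
Qed.

HB.instance Definition _ := isGroup.Build affine
  affine_mulA affine_mul1g affine_mulg1 affine_mulVg affine_mulgV.

Lemma affine_expg r u m :
  (((r, u) : affine) ^+ m)%g = (r *+ m, (\sum_(k < m) chi r ^+ k) * u).
Proof.
elim: m => [|m IHm]; first by rewrite expg0 mulr0n big_ord0 mul0r.
rewrite expgS IHm [LHS]/(affine_mul _ _) /affine_mul /= -mulrS big_ord_recl expr0.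
rewrite mulrDl mul1r mulrA mulr_sumr.
by under [in RHS]eq_bigr do rewrite exprS.
Qed.

(** The geometric sum of x = chi r vanishes only if x ^+ m = 1 with x <> 1; for
    x = 1 it is m, which is nonzero in characteristic 0. *)
Lemma char_sum_neq0 r m : (0 < m)%N -> \sum_(k < m) chi r ^+ k != 0.
Proof.
move=> m_gt0; have [->|r_neq0] := eqVneq r 0.
  by rewrite char0 sum_expr1n pnatr_eq0 -lt0n.
apply/eqP => sum0; case/eqP: r_neq0; apply: (char_tf (t := chi) m_gt0).
by apply/eqP; rewrite -subr_eq0 subrX1 sum0 mulr0.
Qed.

Lemma affine_uniquely_divisible : uniquely_divisible affine.
Proof.
move=> [s v] m m_gt0.
have m_neq0 : m%:R != 0 :> F by rewrite pnatr_eq0 -lt0n.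
exists (s / m%:R, v / \sum_(k < m) chi (s / m%:R) ^+ k); split.
  rewrite affine_expg -[_ *+ m]mulr_natr divfK //; congr pair.
  by rewrite mulrC divfK // char_sum_neq0.
case=> r u; rewrite affine_expg => -[<- <-].
rewrite -[_ *+ m]mulr_natr mulfK //; congr pair.
by rewrite mulrC mulKf // char_sum_neq0.
Qed.

Lemma affine_wsubst w t v s :
  wsubst w ((t, v) : affine) ((s, 0) : affine) =
  (t *+ count isX w + s *+ count (predC isX) w,
   fox w (chi t) (chi s) * v) :> affine.
Proof.
rewrite /wsubst; elim: w => [|l w IHw].
  by rewrite big_nil /= !mulr0n addr0 mul0r.
rewrite big_cons {}IHw; case: l; rewrite [LHS]/(affine_mul _ _) /affine_mul /=.
  by rewrite add1n add0n mulrS addrA; congr pair; ring.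
by rewrite add0n add1n mulrS addrCA; congr pair; ring.
Qed.

(** With 1 as translation part of the right-hand side, comparing exponents leaves
    [r] as the only candidate for X, and there the translation part of the
    left-hand side is 0. *)
Theorem fox_root_unsolvable w r s :
  fox w (chi r) (chi s) = 0 -> ~ solvable_by_radicals w.
Proof.
move=> fox0 /solvable_in_groups /(_ affine affine_uniquely_divisible).
pose b : affine := (r *+ count isX w + s *+ count (predC isX) w, 1).
case/(_ (s, 0) b) => -[t v]; rewrite affine_wsubst => -[/addIr tr].
have [noX|X_gt0] := posnP (count isX w).
  by rewrite fox_noX // mul0r => /esym/eqP; rewrite oner_eq0.
have -> : t = r.
  have: t *+ count isX w == r *+ count isX w by rewrite tr.
  by rewrite -subr_eq0 -mulrnBl mulrn_eq0 -[_ == 0%N]negbK -lt0n X_gt0 subr_eq0 => /eqP.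
by rewrite fox0 mul0r => /esym/eqP; rewrite oner_eq0.
Qed.

End AffineGroup.

(** * Real powers of a negative number *)

Section NegativeRoot.
Variables (R : realType) (t : R).
Hypotheses (t_gt0 : 0 < t) (t_neq1 : t != 1).

(** The branch t^r e^(i pi r) of (-t)^r. *)
Definition neg_pow (r : R) : R[i] :=
  (expR (ln t * r) * cos (pi * r) +i* (expR (ln t * r) * sin (pi * r)))%C.

Lemma neg_pow0 : neg_pow 0 = 1.
Proof. by rewrite /neg_pow !mulr0 expR0 cos0 sin0 mulr1 mulr0. Qed.

Lemma neg_powD r s : neg_pow (r + s) = neg_pow r * neg_pow s.
Proof.
rewrite /neg_pow !mulrDr expRD cosD sinD.
by apply/eqP; rewrite eq_complex /=; apply/andP; split; apply/eqP; ring.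
Qed.

Lemma neg_powMn r m : neg_pow (r *+ m) = neg_pow r ^+ m.
Proof.
elim: m => [|m IHm]; first by rewrite mulr0n neg_pow0.
by rewrite mulrS neg_powD IHm exprS.
Qed.

Lemma neg_powN r : neg_pow (- r) = (neg_pow r)^-1.
Proof.
have h : neg_pow (- r) * neg_pow r = 1 by rewrite -neg_powD addNr neg_pow0.
have u : neg_pow r != 0.
  by apply/eqP => r0; move/eqP: h; rewrite r0 mulr0 eq_sym oner_eq0.
by rewrite -[LHS](mulfK u) h mul1r.
Qed.

Lemma neg_pow_norm r : `|neg_pow r| = (expR (ln t * r))%:C%C.
Proof.
rewrite normc_def /= !exprMn -mulrDr cos2Dsin2 mulr1.
by rewrite sqrtr_sqr ger0_norm ?expR_ge0.
Qed.

(** A root of unity has absolute value 1, whereas that of (-t)^r is t^r. *)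
Lemma neg_pow_tf r m : (0 < m)%N -> neg_pow r ^+ m = 1 -> r = 0.
Proof.
move=> m_gt0 /(congr1 Num.norm); rewrite normrX normr1 neg_pow_norm => /eqP.
rewrite pexprn_eq1 ?ler0c ?expR_ge0 // eqn0Ngt m_gt0 /= => /eqP[/eqP].
rewrite -(expR0 R) (inj_eq (@expR_inj R)) mulf_eq0 ln_eq0 // (negbTE t_neq1).
by move/eqP.
Qed.

Definition neg_pow_character : tf_character R R[i] :=
  TfCharacter neg_pow0 neg_powD neg_pow_tf.

Lemma neg_pow1 : neg_pow 1 = (- t)%:C%C.
Proof.
by rewrite /neg_pow !mulr1 lnK // cospi sinpi mulr0 mulrN1.
Qed.

Lemma neg_pow_unsolvable w (r s : R) :
  fox w (neg_pow r) (neg_pow s) = 0 -> ~ solvable_by_radicals w.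
Proof. exact: (@fox_root_unsolvable _ _ neg_pow_character). Qed.

Lemma neg_pow2 : neg_pow 2 = (t ^+ 2)%:C%C.
Proof. by rewrite (neg_powMn 1) neg_pow1 -rmorphXn sqrrN. Qed.

Lemma real_neg_pow_unsolvable w (r s x a : R) :
  neg_pow r = x%:C%C -> neg_pow s = a%:C%C -> fox w x a = 0 ->
  ~ solvable_by_radicals w.
Proof.
move=> rx sa fox0; apply: (@neg_pow_unsolvable _ r s).
by rewrite rx sa fox_morph fox0 rmorph0.
Qed.

End NegativeRoot.

(** * Roots of the Fox derivatives *)

Section Families.
Variable R : realType.
Implicit Types t : R.

(** Keeping the interval on one side of 1 makes the root avoid the value t = 1,
    at which (-t)^r is a character with torsion. *)
Lemma sign_change_root (p : {poly R}) (a b : R) : 0 <= a -> a < b ->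
  (b <= 1) || (1 <= a) -> p.[a] * p.[b] < 0 ->
  exists t, [/\ 0 < t, t != 1 & p.[t] = 0].
Proof.
move=> a_ge0 ab off1 /(poly_ivtoo (ltW ab))[t]; rewrite in_itv /= => /andP[at_ tb].
move=> /rootP pt0; exists t; split=> //; first exact: le_lt_trans at_.
case/orP: off1 => [b1|a1]; first by rewrite lt_eqF // (lt_le_trans tb).
by rewrite gt_eqF // (le_lt_trans a1).
Qed.

(** The value at 1 is n - m. If n < m, compare it with the value 1 at 0; if m < n,
    compare it with the value at 2, where the second term dominates. *)
Lemma unbalanced_root m n : (1 <= m)%N -> (1 <= n)%N -> m <> n ->
  exists t, [/\ 0 < t, t != 1 &
  \sum_(k < n) t ^+ 2 ^+ k - t * t ^+ 2 ^+ n * \sum_(k < m) t ^+ 2 ^+ k = 0].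
Proof.
move=> m_ge1 n_ge1 neq_mn.
pose p : {poly R} := \sum_(k < n) 'X ^+ 2 ^+ k -
  'X * 'X ^+ 2 ^+ n * \sum_(k < m) 'X ^+ 2 ^+ k.
have pE t : p.[t] =
    \sum_(k < n) t ^+ 2 ^+ k - t * t ^+ 2 ^+ n * \sum_(k < m) t ^+ 2 ^+ k.
  rewrite /p !hornerE !horner_sum.
  by congr (_ - _ * _); apply: eq_bigr => k _; rewrite !hornerE.
have p1 : p.[1] = n%:R - m%:R.
  by rewrite pE !expr1n !mul1r !sum_expr1n.
suff [t [t_gt0 t1 pt]] : exists t, [/\ 0 < t, t != 1 & p.[t] = 0].
  by exists t; rewrite -pE.
have [lt_nm|lt_mn|eq_nm] := ltngtP n m; last by case: neq_mn.
  apply: (@sign_change_root _ 0 1); rewrite ?lexx ?ltr01 //.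
  have -> : p.[0] = 1.
    rewrite pE !mul0r subr0; case: n n_ge1 {p pE p1 lt_nm neq_mn} => // n _.
    rewrite big_ord_recl expr0 big1 ?addr0 // => k _.
    by rewrite expr2 mul0r expr0n.
  by rewrite mul1r p1 subr_lt0 ltr_nat.
apply: (@sign_change_root _ 1 2); rewrite ?lexx ?orbT ?ler01 ?ltr1n //.
rewrite pmulr_rlt0; last by rewrite p1 subr_gt0 ltr_nat.
rewrite pE; have := subrX1 (2 ^+ 2 : R) n.
have : 0 < (2 ^+ 2 : R) ^+ n by rewrite exprn_gt0 // exprn_gt0.
have : 1 <= \sum_(k < m) (2 ^+ 2 : R) ^+ k.
  case: m m_ge1 {p pE p1 lt_mn neq_mn} => // m _.
  rewrite big_ord_recl expr0 lerDl sumr_ge0 // => k _.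
  by rewrite exprn_ge0 // exprn_ge0.
nra.
Qed.

(** The value at 1 is 2 - n, negative by the hypothesis, while at 2 the leading
    term 4^n exceeds 2 (4^n - 1) / 3. *)
Lemma palindromic_root n : (3 <= n)%N -> exists t, [/\ 0 < t, t != 1 &
  1 + t ^+ 2 ^+ n - t * \sum_(k < n) t ^+ 2 ^+ k = 0].
Proof.
move=> n_ge3.
pose p : {poly R} := 1 + 'X ^+ 2 ^+ n - 'X * \sum_(k < n) 'X ^+ 2 ^+ k.
have pE t : p.[t] = 1 + t ^+ 2 ^+ n - t * \sum_(k < n) t ^+ 2 ^+ k.
  rewrite /p !hornerE horner_sum; congr (_ - _ * _).
  by apply: eq_bigr => k _; rewrite !hornerE.
suff [t [t_gt0 t1 pt]] : exists t, [/\ 0 < t, t != 1 & p.[t] = 0].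
  by exists t; rewrite -pE.
apply: (@sign_change_root _ 1 2); rewrite ?lexx ?orbT ?ler01 ?ltr1n //.
rewrite nmulr_rlt0; last first.
  by rewrite pE !expr1n mul1r sum_expr1n -[1 + 1]/(2%:R) subr_lt0 ltr_nat.
rewrite pE; have := subrX1 (2 ^+ 2 : R) n.
have : 0 < (2 ^+ 2 : R) ^+ n by rewrite exprn_gt0 // exprn_gt0.
lra.
Qed.

Lemma cubic_root : exists t, [/\ 0 < t, t != 1 & t ^+ 3 - t - 1 = 0].
Proof.
have [t] : exists t, [/\ 0 < t, t != 1 & ('X ^+ 3 - 'X - 1 : {poly R}).[t] = 0].
  apply: (@sign_change_root _ 1 2); rewrite ?lexx ?orbT ?ler01 ?ltr1n //.
  by rewrite !hornerE; lra.
by rewrite !hornerE => ?; exists t.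
Qed.

(** * The four families of words *)

(** With x = (-t)^2 and a = (-t)^1, the Fox derivative
    (1 + ... + x^(n-1)) + x^n a (1 + ... + x^(m-1)) becomes the left-hand side of
    the equation in [unbalanced_root]. *)
Lemma unsolvable_XnAXm m n : (1 <= m)%N -> (1 <= n)%N -> m <> n ->
  ~ solvable_by_radicals (nseq n LX ++ [:: LA] ++ nseq m LX).
Proof.
move=> m_ge1 n_ge1 neq_mn; have [t [t0 t1 tE]] := unbalanced_root m_ge1 n_ge1 neq_mn.
apply: (@real_neg_pow_unsolvable _ _ t0 t1 _ 2 1 (t ^+ 2) (- t)).
- exact: neg_pow2.
- exact: neg_pow1.
rewrite fox_cat fox_nseqX ab_eval_nseqX /= fox_nseqX -[RHS]tE; ring.
Qed.

(** In terms of b = a^n and d = x a^(m+n), the Fox derivative is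
    1 + d b + d^2 b + d^3 = (1 + d) (1 - d + d^2 + d b). The exponents [r] and [s]
    are chosen so that b = (-t)^1 and d = (-t)^2; the last factor becomes
    1 - t^2 + t^4 - t^3 = (t - 1) (t^3 - t - 1). *)
Lemma unsolvable_XAXAXAX m n : (1 <= n)%N ->
  ~ solvable_by_radicals
      ([:: LX] ++ nseq (m + 2 * n) LA ++ [:: LX] ++ nseq (m + n) LA ++
       [:: LX] ++ nseq m LA ++ [:: LX]).
Proof.
move=> n_gt0; have [t [t0 t1 tE]] := cubic_root.
have n_neq0 : n%:R != 0 :> R by rewrite pnatr_eq0 -lt0n.
pose s : R := n%:R^-1; pose r : R := 2 - s *+ (m + n).
apply: (@neg_pow_unsolvable _ _ t0 t1 _ r s).
set x := neg_pow t r; set a := neg_pow t s.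
have ab : a ^+ n = (- t)%:C%C by rewrite -neg_powMn -mulr_natr mulVf // neg_pow1.
have xd : x * a ^+ (m + n) = (t ^+ 2)%:C%C.
  by rewrite -neg_powMn -neg_powD subrK neg_pow2.
rewrite !(fox_cat, ab_eval_nseqA, fox_nseqA) /=.
transitivity (1 + x * a ^+ (m + n) * a ^+ n * (1 + x * a ^+ (m + n)) +
              (x * a ^+ (m + n)) ^+ 3).
  by rewrite mul2n -addnn !exprD; ring.
transitivity ((1 + t ^+ 2) * (t - 1) * (t ^+ 3 - t - 1))%:C%C.
  by rewrite ab xd; ring.
by rewrite tE mulr0.
Qed.

(** With c = x a, the Fox derivative is 1 + c (1 + ... + x^(n-1)) + c^2 x^(n-1);
    the choice x = (-t)^2, c = (-t)^1, hence a = (-t)^(-1), gives the polynomial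
    of [palindromic_root]. *)
Lemma unsolvable_XAXnAX n : (3 <= n)%N ->
  ~ solvable_by_radicals ([:: LX; LA] ++ nseq n LX ++ [:: LA; LX]).
Proof.
move=> n_ge3; have [t [t0 t1 tE]] := palindromic_root n_ge3.
apply: (@real_neg_pow_unsolvable _ _ t0 t1 _ 2 (-1) (t ^+ 2) (- t)^-1).
- exact: neg_pow2.
- by rewrite neg_powN neg_pow1 // fmorphV.
rewrite !fox_cat fox_nseqX ab_eval_nseqX /= -[RHS]tE.
by field; rewrite gt_eqF.
Qed.

(** With c = a x, the Fox derivative is 1 + x (1 + ... + c^n) + x^2 c^n. This is
    the polynomial of the family X A X^(n+1) A X with the pair (c, x) in place of
    (x, c), so here c = (-t)^2 and x = (-t)^1, hence a = (-t)^1. *)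
Lemma unsolvable_XXAXnX n : (2 <= n)%N ->
  ~ solvable_by_radicals
      ([:: LX; LX] ++ flatten (nseq n [:: LA; LX]) ++ [:: LX]).
Proof.
move=> n_ge2; have [t [t0 t1 tE]] := @palindromic_root n.+1 n_ge2.
apply: (@real_neg_pow_unsolvable _ _ t0 t1 _ 1 1 (- t) (- t)).
- exact: neg_pow1.
- exact: neg_pow1.
rewrite !fox_cat fox_pow ab_eval_pow /= -[RHS]tE.
have aX : - t * (- t * 1) = t ^+ 2 by ring.
have -> : \sum_(k < n.+1) t ^+ 2 ^+ k = 1 + t ^+ 2 * \sum_(k < n) t ^+ 2 ^+ k.
  by rewrite big_ord_recl mulr_sumr; under [in RHS]eq_bigr do rewrite -exprS.
by rewrite aX (exprS (t ^+ 2)); ring.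
Qed.

End Families.

Local Close Scope ring_scope.

Theorem corollary1p8 :
  [/\ (* X^n A X^m *)
      forall m n : nat, 1 <= m -> 1 <= n -> m <> n ->
        ~ solvable_by_radicals (nseq n LX ++ [:: LA] ++ nseq m LX),
      (* X A^(m+2n) X A^(m+n) X A^m X *)
      forall m n : nat, 1 <= n ->
        ~ solvable_by_radicals
            ([:: LX] ++ nseq (m + 2 * n) LA ++ [:: LX] ++ nseq (m + n) LA ++
             [:: LX] ++ nseq m LA ++ [:: LX]),
      (* X A X^n A X *)
      forall n : nat, 3 <= n ->
        ~ solvable_by_radicals ([:: LX; LA] ++ nseq n LX ++ [:: LA; LX])
    & (* X^2 (A X)^n X *)
      forall n : nat, 2 <= n ->
        ~ solvable_by_radicals
            ([:: LX; LX] ++ flatten (nseq n [:: LA; LX]) ++ [:: LX])].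
Proof.
split=> [m n|m n|n|n].
- exact: (unsolvable_XnAXm Rdefinitions.R).
- exact: (unsolvable_XAXAXAX Rdefinitions.R).
- exact: (unsolvable_XAXnAX Rdefinitions.R).
- exact: (unsolvable_XXAXnX Rdefinitions.R).
Qed.
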